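(* Let $\Omega$ be a bounded open subset of $\mathbb{R}^n$, let $B^{(1)},\dots,B^{(n)}$ and $C$ be real $m\times m$ matrices with constant entries, and let $1\le k\le m$. Suppose that the matrices $B^{(i)}$, $i=1,\dots,n$, have a common eigenspace of dimension $k$, and let $\hat Q$ be an invertible real $m\times m$ matrix, whose first $k$ columns are (linearly independent) common eigenvectors of all the $B^{(i)}$, such that for every $i=1,\dots,n$ the matrix $J^{(i)}=\hat Q^{-1}B^{(i)}\hat Q$ is a real Jordan canonical form of $B^{(i)}$ whose $k\times m$ sub-matrix consisting of the first $k$ rows has the form $\big(\Lambda^{(i)}\;|\;0\big)$, where $\Lambda^{(i)}$ is a real diagonal $k\times k$ matrix and $0$ is the $k\times(m-k)$ zero matrix. Assume in addition that the $k\times m$ sub-matrix consisting of the first $k$ rows of $\hat C=\hat Q^{-1}C\hat Q$ has the form $\big(\Gamma\;|\;0\big)$, where $\Gamma$ is a cooperative $k\times k$ matrix and $0$ is the $k\times(m-k)$ zero matrix. Let $p_{ij}$ be the entries of $\hat P:=\hat Q^{-1}$. If all the entries of the first $k$ rows of $\hat P$ are nonnegative, then the closed convex set $$\hat S=\Big\{u\in\mathbb{R}^m:\ \sum_{j=1}^m p_{1j}u_j\le 0,\ \dots,\ \sum_{j=1}^m p_{kj}u_j\le 0\Big\}$$ is invariant for the system $$Au+\sum_{i=1}^n B^{(i)}D_iu+Cu\ge 0\quad\text{in }\Omega .$$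
   Context: For a vector-valued function $u=(u_1,\dots,u_m)$ on $\Omega\subset\mathbb{R}^n$, $Au=(\Delta u_1,\dots,\Delta u_m)^T$ and $D_iu=\big(\frac{\partial u_1}{\partial x_i},\dots,\frac{\partial u_m}{\partial x_i}\big)^T$. Inequalities between vectors are componentwise. A common eigenspace of dimension $k$ means a $k$-dimensional subspace of $\mathbb{R}^m$ having a basis of vectors each of which is an eigenvector of every $B^{(i)}$ (with real eigenvalue possibly depending on $i$ and on the vector). A real $k\times k$ matrix $M=(m_{jl})$ is cooperative if $m_{jl}\ge 0$ for all $j\ne l$ and $\sum_{l=1}^k m_{jl}\le 0$ for every $j=1,\dots,k$. A set $S\subseteq\mathbb{R}^m$ is invariant for the system if every $u\in[C^2(\Omega)]^m\cap[C^0(\overline\Omega)]^m$ satisfying the system of inequalities in $\Omega$ has the property: if $u(x)\in S$ for all $x\in\partial\Omega$, then $u(x)\in S$ for all $x\in\Omega$. *)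

(* Defs.v *)
From HB Require Import structures.
From mathcomp Require Import all_boot all_order all_algebra.
From mathcomp Require Import all_classical all_reals all_analysis.
Set Implicit Arguments.
Unset Strict Implicit.
Unset Printing Implicit Defensive.
Import Order.TTheory GRing.Theory Num.Theory.
Import numFieldNormedType.Exports.
Local Open Scope classical_set_scope.
Local Open Scope ring_scope.

Section LinearAlgebra.
Context {R : realType}.

(* MathComp's [eigenvalue]/[eigenspace] act on row vectors; column eigenvectors
   are needed here. *)
Definition is_eigenvector {m} (A : 'M[R]_m) (v : 'cV[R]_m) : Prop :=
  v != 0 /\ exists a : R, A *m v = a *: v.

Definition is_common_eigenvector {n m} (B : 'I_n -> 'M[R]_m) (v : 'cV[R]_m) : Prop :=
  forall i, is_eigenvector (B i) v.

Definition common_eigenspace {n m} (B : 'I_n -> 'M[R]_m)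
    (V : {vspace 'cV[R]_m}) : Prop :=
  exists2 X : seq 'cV[R]_m, basis_of V X & {in X, forall v, is_common_eigenvector B v}.

Definition cooperative {k} (M : 'M[R]_k) : Prop :=
  (forall j l, j != l -> 0 <= M j l) /\ (forall j, \sum_l M j l <= 0).

Definition jordan_mx (d : nat) (a : R) : 'M[R]_d :=
  \matrix_(i, j) if i == j then a else ((i.+1 == j)%N)%:R.

(* The real block of a pair of conjugate eigenvalues a +/- ib: 2 x 2 blocks
   [a, b; -b, a] on the diagonal and identity 2 x 2 blocks just above. *)
Definition jordan2_mx (h : nat) (a b : R) : 'M[R]_(h.*2) :=
  \matrix_(i, j)
    if i == j then a
    else if (i.+2 == j)%N then 1
    else if ~~ odd i && (i.+1 == j)%N then b
    else if odd i && (i == j.+1 :> nat) then - b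
    else 0.

Inductive real_jordan_block : forall d, 'M[R]_d -> Prop :=
| Real_jordan_block d a : (0 < d)%N -> real_jordan_block (jordan_mx d a)
| Complex_jordan_block h a b :
    (0 < h)%N -> b != 0 -> real_jordan_block (jordan2_mx h a b).

Definition real_jordan_form {m} (J : 'M[R]_m) : Prop :=
  exists (s : nat) (d : 'I_s -> nat) (F : forall i, 'M[R]_(d i))
         (e : (\sum_i d i)%N = m),
    (forall i, real_jordan_block (F i)) /\ J = castmx (e, e) (\mxdiag_i F i).

Definition first_rows {k m} (km : (k <= m)%N) (M : 'M[R]_m) : 'M[R]_(k, m) :=
  rowsub (widen_ord km) M.

(* The k x m matrix (L | 0). *)
Definition pad_row0 {k m} (km : (k <= m)%N) (L : 'M[R]_k) : 'M[R]_(k, m) :=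
  castmx (erefl k, subnKC km) (row_mx L (0 : 'M[R]_(k, m - k))).

End LinearAlgebra.

Section System.
Context {R : realType} {n : nat}.
Implicit Types (Omega : set 'rV[R]_n) (f : 'rV[R]_n -> R).

Definition partial (i : 'I_n) f : 'rV[R]_n -> R := 'D_(delta_mx 0 i) f.

Definition laplacian f (x : 'rV[R]_n) : R := \sum_(i < n) partial i (partial i f) x.

(* Meant for open [Omega], where the partial derivatives at a point of [Omega]
   depend only on the values of [f] in [Omega]. *)
Fixpoint Cr (r : nat) Omega f : Prop :=
  (forall x, Omega x -> {for x, continuous f}) /\
  if r is r'.+1 then
    forall i, (forall x, Omega x -> derivable f x (delta_mx 0 i)) /\
              Cr r' Omega (partial i f)
  else True.

Definition boundary Omega : set 'rV[R]_n := closure Omega `\` Omega°.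

Context {m : nat}.
Implicit Types u : 'rV[R]_n -> 'cV[R]_m.

Definition component u (j : 'I_m) : 'rV[R]_n -> R := fun x => u x j 0.

Definition vpartial (i : 'I_n) u (x : 'rV[R]_n) : 'cV[R]_m :=
  \col_j partial i (component u j) x.

Definition vlaplacian u (x : 'rV[R]_n) : 'cV[R]_m :=
  \col_j laplacian (component u j) x.

Definition satisfies_system Omega (B : 'I_n -> 'M[R]_m) (C : 'M[R]_m) u : Prop :=
  forall x, Omega x -> forall j,
    0 <= (vlaplacian u x + \sum_(i < n) B i *m vpartial i u x + C *m u x) j 0.

(* Functions on the closure of [Omega] are represented by total functions whose
   values elsewhere are irrelevant. *)
Definition invariant_set Omega (B : 'I_n -> 'M[R]_m) (C : 'M[R]_m)
    (S : set 'cV[R]_m) : Prop :=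
  forall u,
    (forall j, Cr 2 Omega (component u j)) ->
    {within closure Omega, continuous u} ->
    satisfies_system Omega B C u ->
    (forall x, boundary Omega x -> S (u x)) ->
    forall x, Omega x -> S (u x).

End System.

Definition S_hat {R : realType} {k m : nat} (km : (k <= m)%N) (P : 'M[R]_m) :
    set 'cV[R]_m :=
  [set v | forall i : 'I_k, \sum_(j < m) P (widen_ord km i) j * v j 0 <= 0].

(* Main.v *)
Require Import Defs.
From HB Require Import structures.
From mathcomp Require Import all_boot all_order all_algebra.
From mathcomp Require Import all_classical all_reals all_analysis.
From mathcomp Require Import ring lra.
Set Implicit Arguments.
Unset Strict Implicit.
Unset Printing Implicit Defensive.
Import Order.TTheory GRing.Theory Num.Theory.
Import numFieldNormedType.Exports.
Local Open Scope classical_set_scope.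
Local Open Scope ring_scope.

(** Write P for the inverse of Q and w_j = (P u)_j for the first k rows j; the
    set S_hat is the region w_1 <= 0, ..., w_k <= 0, a finite intersection of
    closed half-spaces, so it is closed and convex.

    Because the first k rows of P are nonnegative, applying them to the vector
    inequality satisfied by u preserves its sign.  Because those rows of
    P B_i Q and P C Q are (Lambda_i | 0) and (Gamma | 0), the result involves
    w_1, ..., w_k only and is coupled only through the zero-order terms
    ([first_rows_conj_mul], [first_rows_system]):
      Delta w_j + sum_i (Lambda_i)_jj d_i w_j + sum_l Gamma_jl w_l >= 0.

    It remains to see that such a cooperative system satisfies the maximum
    principle.  Suppose first that the inequalities are strict, and let x be a
    point and l an index where the largest value M of all the components is
    attained.  If x is interior, the gradient of the l-th component vanishes at
    x and its pure second derivatives are nonpositive, while off-diagonal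
    nonnegativity gives
      sum_p Gamma_lp w_p(x) <= M sum_p Gamma_lp,
    which is nonpositive when M >= 0 since row sums are nonpositive: this
    contradicts strictness.  So a nonnegative bound on the boundary holds
    everywhere ([cooperative_strict_max_principle]).  The general case reduces
    to the strict one by adding a small multiple of exp(a x_i0), a large, to
    every component ([cooperative_max_principle]). *)

(** * Second derivatives at a maximum *)

(** Reduces directional derivatives to derivatives of a function of one real
    variable: both are limits of literally the same difference quotients. *)
Lemma is_derive_lineP {R : realType} {V : normedModType R} (f : V -> R)
    (x e : V) (t d : R) :
  is_derive (t *: e + x) e f d <->
  is_derive t 1 (fun s => f (s *: e + x)) d.
Proof.
have E : (fun h : R => h^-1 *: ((f \o shift (t *: e + x)) (h *: e)
                                - f (t *: e + x))) =
    (fun h : R => h^-1 *: (((fun s => f (s *: e + x)) \o shift t) (h *: (1 : R))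
                           - f (t *: e + x))).
  apply/funext => h /=; congr (_ *: (f _ - _)).
  by rewrite addrA -scalerDl [h *: 1]mulr1.
by split=> -[]; rewrite /derivable /derive -?E ?E => *; constructor;
  rewrite /derivable /derive -?E ?E.
Qed.

(** If the second derivative were positive, the Caratheodory slope of [g] at 0
    would be positive nearby; as [g 0 = 0], [g] would be positive just to the
    right of 0 and [f] would increase there. *)
Lemma second_derivative_test {R : realType} (f g : R -> R) (r h : R) :
  0 < r -> (forall t : R, `|t| < r -> is_derive t 1 f (g t)) ->
  is_derive (0 : R) 1 g h -> (forall t, `|t| < r -> f t <= f 0) ->
  g 0 = 0 /\ h <= 0.
Proof.
move=> r0 df dg fmax.
have itvE t : (t \in `]- r, r[) = (`|t| < r) by rewrite in_itv /= ltr_norml.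
have g0 : g 0 = 0.
  have d0 : is_derive (0 : R) 1 f 0.
    apply: (@derive1_at_max _ _ (- r) r); rewrite ?itvE ?normr0 //.
    - by rewrite ge0_cp // ltW.
    - by move=> t; rewrite itvE => /df[].
    - by move=> t; rewrite itvE => /fmax.
  have := df 0; rewrite normr0 => /(_ r0) -[_ <-].
  by case: d0.
split=> //; rewrite leNgt; apply/negP => h0.
have /is_derive1_caratheodory[q [gq qcont q0]] := dg.
have /nbhs_ballP[s /= s0 sq] : \forall t \near (0 : R), 0 < q t.
  by apply: (cvgr_gt (q 0) qcont); rewrite q0.
pose d := Num.min r s / 2.
have d0 : 0 < d by rewrite divr_gt0 // lt_min r0.
have d_lt : d < Num.min r s by rewrite /d; move: d0; rewrite /d; lra.
have [dr ds] : d < r /\ d < s by move: d_lt; rewrite lt_min => /andP.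
have /(_ _ _ (lexx 0) d0 (lexx d)) : forall x y, 0 <= x -> x < y -> y <= d -> f x < f y.
  apply: gtr0_derive1_incr.
  - move=> t; rewrite in_itv /= => /andP[t0 td].
    by case: (df t) => //; rewrite gtr0_norm // (lt_trans td).
  - move=> t; rewrite in_itv /= => /andP[t0 td].
    have [|_] := df t; first by rewrite gtr0_norm // (lt_trans td).
    rewrite derive1E => ->.
    have := gq t; rewrite g0 !subr0 => ->; rewrite mulr_gt0 //.
    by apply: sq; rewrite /ball /= sub0r normrN gtr0_norm // (lt_trans td).
  - apply: derivable_within_continuous => t; rewrite in_itv /= => /andP[t0 td].
    by case: (df t) => //; rewrite ger0_norm // (le_lt_trans td).
by apply/negP; rewrite -leNgt; apply: fmax; rewrite gtr0_norm.
Qed.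

Section SecondPartials.
Context {R : realType} {n : nat}.
Implicit Types (Omega : set 'rV[R]_n) (f : 'rV[R]_n -> R).

(** The derivatives are carried as data, rather than as iterated [partial],
    because linearity of the second derivative then needs no argument about
    the first derivatives agreeing near the point. *)
Definition second_partials Omega f (g h : 'I_n -> 'rV[R]_n -> R) : Prop :=
  forall i x, Omega x ->
    is_derive x (delta_mx 0 i) f (g i x) /\
    is_derive x (delta_mx 0 i) (g i) (h i x).

Lemma Cr2_second_partials Omega f : Cr 2 Omega f ->
  second_partials Omega f (fun i => partial i f)
    (fun i => partial i (partial i f)).
Proof.
by move=> [_ /= df] i x Ox; have [d1 [_ /(_ i)[d2 _]]] := df i; split;
  apply: DeriveDef => //; [exact: d1 | exact: d2].
Qed.

Lemma second_partialsD Omega f1 g1 h1 f2 g2 h2 :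
  second_partials Omega f1 g1 h1 -> second_partials Omega f2 g2 h2 ->
  second_partials Omega (f1 + f2) (fun i => g1 i + g2 i)
    (fun i => h1 i + h2 i).
Proof.
move=> d1 d2 i x Ox; have [? ?] := d1 i x Ox; have [? ?] := d2 i x Ox.
by split; apply: is_deriveD.
Qed.

Lemma second_partialsZ Omega c f g h : second_partials Omega f g h ->
  second_partials Omega (c \*: f) (fun i => c \*: g i) (fun i => c \*: h i).
Proof.
by move=> d i x Ox; have [? ?] := d i x Ox; split; apply: is_deriveZ.
Qed.

Lemma second_partials_sum Omega m (f : 'I_m -> 'rV[R]_n -> R) g h :
  (forall l, second_partials Omega (f l) (g l) (h l)) ->
  second_partials Omega (\sum_l f l) (fun i => \sum_l g l i)
    (fun i => \sum_l h l i).
Proof.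
move=> d i x Ox; split.
  apply: is_derive_eq (is_derive_sum (fun l => (d l i x Ox).1)) _.
  by rewrite fct_sumE.
apply: is_derive_eq (is_derive_sum (fun l => (d l i x Ox).2)) _.
by rewrite fct_sumE.
Qed.

Lemma second_partials_max Omega f g h x i : open Omega -> Omega x ->
  second_partials Omega f g h -> (forall y, Omega y -> f y <= f x) ->
  g i x = 0 /\ h i x <= 0.
Proof.
move=> oO Ox d fmax; pose e : 'rV[R]_n := delta_mx 0 i.
have near0 : \forall t \near (0 : R), Omega (t *: e + x).
  have : (t *: e + x) @[t --> (0 : R)] --> 0 *: e + x.
    apply: cvgD; last exact: cvg_cst.
    by apply: cvgZl; exact: cvg_id.
  by apply; rewrite scale0r add0r; apply: open_nbhs_nbhs.
have /nbhs_ballP[r /= r0 rO] := near0.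
have {}rO t : `|t| < r -> Omega (t *: e + x).
  by move=> tr; apply: rO; rewrite /ball /= sub0r normrN.
have x0 : 0 *: e + x = x by rewrite scale0r add0r.
have := @second_derivative_test R (fun t => f (t *: e + x))
  (fun t => g i (t *: e + x)) r (h i x) r0.
rewrite x0; apply=> [t tr||t tr].
- by apply/(is_derive_lineP f x e); case: (d i _ (rO t tr)).
- by apply/(is_derive_lineP (g i) x e); rewrite x0; case: (d i _ Ox).
- exact: fmax (rO _ _).
Qed.

Lemma second_partials_exp Omega (a : R) (i0 : 'I_n) :
  second_partials Omega (fun x => expR (a * x 0 i0))
    (fun i x => (i == i0)%:R * a * expR (a * x 0 i0))
    (fun i x => (i == i0)%:R * a ^+ 2 * expR (a * x 0 i0)).
Proof.
have dE i x : is_derive x (delta_mx 0 i : 'rV[R]_n)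
    (fun x => expR (a * x 0 i0)) ((i == i0)%:R * a * expR (a * x 0 i0)).
  rewrite -[x in is_derive x _ _ _](add0r x) -(scale0r (delta_mx 0 i)).
  apply/(is_derive_lineP (fun x : 'rV[R]_n => expR (a * x 0 i0))).
  pose A s := (a * (i == i0)%:R) * s + a * x 0 i0.
  have -> : (fun s : R => expR (a * (s *: delta_mx 0 i + x) 0 i0)) = expR \o A.
    apply/funext => s /=; rewrite /A !mxE eqxx /= [i0 == i]eq_sym; congr expR; ring.
  have dA : is_derive (0 : R) 1 A (a * (i == i0)%:R).
    apply: is_derive_eq; rewrite ?scaler0 ?addr0 ?add0r; exact: mulr1.
  apply: is_derive_eq (is_derive1_comp (is_derive_expR (A 0)) dA) _.
  by rewrite /A mulr0 add0r mulrC [a * _]mulrC.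
move=> i x _; split; first exact: dE.
apply: is_derive_eq (is_deriveZ ((i == i0)%:R * a) (dE i x)) _.
by rewrite /GRing.scale /=; case: eqP => _ /=; ring.
Qed.

End SecondPartials.

(** * Maximum principle for cooperative systems *)

Section MaximumPrinciple.
Context {R : realType} {n : nat}.
Implicit Types (Omega : set 'rV[R]_n).

Lemma bounded_closure_compact Omega : bounded_set Omega -> compact (closure Omega).
Proof.
move=> [M [Mreal OM]]; apply: bounded_closed_compact; last exact: closed_closure.
exists M; split=> // K MK x clx /=.
have cK : closed [set y : 'rV[R]_n | `|y| <= K].
  apply: (@preimage_closed _ _ (fun y : 'rV[R]_n => `|y|) [set z | z <= K]).
    by move=> y _; exact: norm_continuous.
  exact: closed_le.
move: clx; rewrite closureE => /(_ [set y : 'rV[R]_n | `|y| <= K]); apply.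
by split=> // y Oy; exact: OM Oy.
Qed.

(** The bound [c] on the boundary is nonnegative and not arbitrary: at an interior
    maximum the zero-order term is only known to be at most the value of the
    maximum times a nonpositive row sum, which has a sign only when that value
    is nonnegative. *)
Lemma cooperative_strict_max_principle k Omega (b : 'I_n -> 'I_k -> R)
    (Gamma : 'M[R]_k) (v : 'I_k -> 'rV[R]_n -> R) g h c :
  open Omega -> bounded_set Omega -> cooperative Gamma -> 0 <= c ->
  (forall j, {within closure Omega, continuous (v j)}) ->
  (forall j, second_partials Omega (v j) (g j) (h j)) ->
  (forall j x, Omega x ->
     0 < \sum_i (h j i x + b i j * g j i x) + \sum_l Gamma j l * v l x) ->
  (forall j x, boundary Omega x -> v j x <= c) ->
  forall j x, closure Omega x -> v j x <= c.
Proof.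
move=> oO bO [Goff Grow] c0 cv dv Lv vb j x clx.
have /choice[y ymax] : forall l, exists y, closure Omega y /\
    forall z, closure Omega z -> v l z <= v l y.
  move=> l; have clO0 : closure Omega !=set0 by exists x.
  have [y] := compact_EVT_max clO0 (bounded_closure_compact bO) (cv l).
  by rewrite inE => cly ymax; exists y; split=> // z clz; apply: ymax; rewrite inE.
(* [l] is the component with the largest maximum, so that [v l (y l)] bounds
   every component on the whole closure. *)
have [l _ lmax] := @arg_maxP _ _ _ j xpredT (fun l => v l (y l)) isT.
have vmax p z : closure Omega z -> v p z <= v l (y l).
  by move=> clz; apply: le_trans (lmax p isT); apply: (ymax p).2.
apply: le_trans (vmax j x clx) _; rewrite leNgt; apply/negP => cM.
have Oy : Omega (y l).
  apply: contrapT => nOy; move: cM; apply/negP; rewrite -leNgt; apply: vb.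
  split; first exact: (ymax l).1.
  by move/interior_id: oO => ->.
have := Lv l _ Oy; apply/negP; rewrite -leNgt.
have dmax i : g l i (y l) = 0 /\ h l i (y l) <= 0.
  apply: second_partials_max oO Oy (dv l) _ => z Oz.
  by apply: vmax; apply: subset_closure.
rewrite -[leRHS]addr0 lerD //.
  by apply: sumr_le0 => i _; have [-> ?] := dmax i; rewrite mulr0 addr0.
apply: (@le_trans _ _ (\sum_p Gamma l p * v l (y l))).
  apply: ler_sum => p _; have [->//|lp] := eqVneq l p.
  by apply: ler_wpM2l; [exact: Goff | exact: vmax (ymax l).1].
rewrite -mulr_suml mulr_le0_ge0 // ltW //; exact: le_lt_trans c0 cM.
Qed.

(** Adding [d * exp(a z_i0)] to every component makes the inequalities strict:
    it contributes [(a^2 + b_i0 a + s) d exp(a z_i0)], where [s] is a row sum of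
    [Gamma], and this is positive once [a >= 1] and [a > |b_i0| + |s|].  On
    the bounded domain the perturbation is at most [e] for [d] small, and [e]
    is arbitrary. *)
Lemma cooperative_max_principle k Omega (i0 : 'I_n) (b : 'I_n -> 'I_k -> R)
    (Gamma : 'M[R]_k) (w : 'I_k -> 'rV[R]_n -> R) g h :
  open Omega -> bounded_set Omega -> cooperative Gamma ->
  (forall j, {within closure Omega, continuous (w j)}) ->
  (forall j, second_partials Omega (w j) (g j) (h j)) ->
  (forall j x, Omega x ->
     0 <= \sum_i (h j i x + b i j * g j i x) + \sum_l Gamma j l * w l x) ->
  (forall j x, boundary Omega x -> w j x <= 0) ->
  forall j x, closure Omega x -> w j x <= 0.
Proof.
move=> oO bO cG cw dw Lw wb j x clx.
pose s p := \sum_l Gamma p l.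
(* Summing over [p] gives one exponent that works for all components. *)
pose a := 1 + \sum_p (`|b i0 p| + `|s p|).
have a_gt p : `|b i0 p| + `|s p| < a.
  by rewrite /a (bigD1 p) //= addrCA ltrDl ltr_pwDl // sumr_ge0.
have a1 : 1 <= a by rewrite lerDl sumr_ge0 // => q _; rewrite addr_ge0.
have pos p : 0 < a ^+ 2 + b i0 p * a + s p.
  have := a_gt p; have := ler_norm (- b i0 p); have := ler_norm (- s p).
  have := normr_ge0 (s p); rewrite !normrN; nra.
pose E (z : 'rV[R]_n) := expR (a * z 0 i0).
have cE : continuous E.
  move=> z; apply: (@continuous_comp _ _ _ (fun z : 'rV[R]_n => a * z 0 i0) expR).
    apply: (@continuous_comp _ _ _ (fun z : 'rV[R]_n => z 0 i0) ( *%R a)).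
      exact: coord_continuous.
    exact: mulrl_continuous.
  exact: continuous_expR.
have clO0 : closure Omega !=set0 by exists x.
have [y _ Emax] := compact_EVT_max clO0 (bounded_closure_compact bO)
  (continuous_subspaceT cE).
apply/ler_addgt0Pl => e e0; rewrite addr0.
pose d := e / E y.
have d0 : 0 < d by rewrite divr_gt0 // expR_gt0.
apply: (@le_trans _ _ ((w j + (d \*: E)) x)).
  by rewrite lerDl mulr_ge0 ?ltW ?expR_gt0.
have dE_le z : closure Omega z -> d * E z <= e.
  move=> clz; rewrite /d mulrAC ler_pdivrMr ?expR_gt0 //.
  by rewrite ler_pM2l // Emax // inE.
have dv p := second_partialsD (dw p)
  (second_partialsZ d (@second_partials_exp _ _ Omega a i0)).
apply: (cooperative_strict_max_principle (b := b) (v := fun p => w p + d \*: E)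
  oO bO cG (ltW e0) _ dv _ _ j clx).
- move=> p; apply: within_continuousD; first exact: cw.
  by apply: continuous_subspaceT => z; apply: (@continuous_comp _ _ _ E ( *%R d));
    [exact: cE | exact: mulrl_continuous].
- move=> p z Oz; apply: (@le_lt_trans _ _ _ _ _ (Lw p z Oz)).
  have Ez : 0 < d * E z by rewrite mulr_gt0 ?expR_gt0.
  have -> : \sum_i ((h p i + (d \*: (fun z => (i == i0)%:R * a ^+ 2 * E z))) z +
       b i p * (g p i + (d \*: (fun z => (i == i0)%:R * a * E z))) z) =
      \sum_i (h p i z + b i p * g p i z) + (a ^+ 2 + b i0 p * a) * (d * E z).
    rewrite [in RHS](_ : (_ + _ * a) * _ =
      \sum_i (i == i0)%:R * ((a ^+ 2 + b i p * a) * (d * E z))).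
      rewrite -big_split /=; apply: eq_bigr => i _.
      transitivity (h p i z + d * ((i == i0)%:R * a ^+ 2 * E z) +
        b i p * (g p i z + d * ((i == i0)%:R * a * E z))) => //.
      by move: (_%:R) => q; ring.
    rewrite (bigD1 i0) //= eqxx mul1r big1 ?addr0 // => i /negPf ->.
    by rewrite mul0r.
  have -> : \sum_l Gamma p l * (w l + d \*: E) z =
      \sum_l Gamma p l * w l z + s p * (d * E z).
    by rewrite mulr_suml -big_split /=; apply: eq_bigr => l _; rewrite mulrDr.
  rewrite addrACA ltrDl -mulrDl; exact: mulr_gt0.
- move=> p z bz; rewrite -[leRHS]add0r; apply: lerD; first exact: wb.
  by apply: dE_le; case: bz.
Qed.

End MaximumPrinciple.

(** * The polyhedron S_hat *)

Lemma continuous_mulmx_coord {R : realType} {m} (P : 'M[R]_m) (j : 'I_m) :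
  continuous (fun v : 'cV[R]_m => (P *m v) j 0).
Proof.
have -> : (fun v : 'cV[R]_m => (P *m v) j 0) =
    (fun v => \sum_l P j l * v l 0) by apply/funext => v; rewrite mxE.
apply: continuous_big => [|l _ v]; first exact: add_continuous.
apply: (@continuous_comp _ _ _ (fun v : 'cV[R]_m => v l 0) ( *%R (P j l))).
  exact: coord_continuous.
exact: mulrl_continuous.
Qed.

Section Polyhedron.
Context {R : realType} {k m : nat}.

Lemma S_hatE (km : (k <= m)%N) (P : 'M[R]_m) :
  S_hat km P = [set v | forall j : 'I_k, (P *m v) (widen_ord km j) 0 <= 0].
Proof.
by apply/funext => v; apply/propext; split=> Sv j; have := Sv j; rewrite mxE.
Qed.

Lemma closed_S_hat (km : (k <= m)%N) (P : 'M[R]_m) : closed (S_hat km P).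
Proof.
have -> : S_hat km P = \bigcap_(j in [set: 'I_k])
    ((fun v : 'cV[R]_m => (P *m v) (widen_ord km j) 0) @^-1` [set y | y <= 0]).
  rewrite S_hatE; apply/funext => v; apply/propext.
  by split=> [Sv j _|Sv j]; [exact: Sv | exact: (Sv j)].
apply: closed_bigI => j _; apply: preimage_closed; last exact: closed_le.
by move=> v _; exact: continuous_mulmx_coord.
Qed.

Lemma convex_S_hat (km : (k <= m)%N) (P : 'M[R]_m) : convex_set (S_hat km P).
Proof.
move=> x y t; rewrite S_hatE !inE => Sx Sy j.
rewrite /conv /= mulmxDr -!scalemxAr mxE [X in X + _]mxE [X in _ + X]mxE.
rewrite -[leRHS]addr0; apply: lerD.
  by apply: mulr_ge0_le0; [exact: ge0 | exact: Sx].
by apply: mulr_ge0_le0; [rewrite subr_ge0; exact: le1 | exact: Sy].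
Qed.
End Polyhedron.

(** * Decoupling the first k rows *)

Lemma pad_row0_mul {R : realType} {k m} (km : (k <= m)%N) (L : 'M[R]_k)
    (z : 'cV[R]_m) :
  pad_row0 km L *m z = L *m rowsub (widen_ord km) z.
Proof.
rewrite /pad_row0; move: (subnKC km); move: (m - k)%N => d e.
case: m / e km z => km z.
rewrite castmx_id -{1}(vsubmxK z) mul_row_col mul0mx addr0; congr (_ *m _).
by apply/matrixP => i j; rewrite !mxE; congr (z _ _); apply: val_inj.
Qed.

(** Since [P A v = (P A Q) (P v)] with [P] the inverse of [Q], the first k
    coordinates of [P A v] see only the first k coordinates of [P v]. *)
Lemma first_rows_conj_mul {R : realType} {k m} (km : (k <= m)%N)
    (A Q : 'M[R]_m) (L : 'M[R]_k) (v : 'cV[R]_m) (j : 'I_k) :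
  Q \in unitmx -> first_rows km (invmx Q *m A *m Q) = pad_row0 km L ->
  (invmx Q *m (A *m v)) (widen_ord km j) 0 =
  \sum_l L j l * (invmx Q *m v) (widen_ord km l) 0.
Proof.
move=> Qu AL.
have -> : invmx Q *m (A *m v) = invmx Q *m A *m Q *m (invmx Q *m v).
  by rewrite -!mulmxA (mulmxA Q) mulmxV // mul1mx.
transitivity ((first_rows km (invmx Q *m A *m Q) *m (invmx Q *m v)) j 0).
  by rewrite /first_rows mul_rowsub_mx [RHS]mxE.
by rewrite AL pad_row0_mul mxE; apply: eq_bigr => l _; rewrite [in LHS]mxE.
Qed.

(** Diagonality of [Lambda i] is what keeps the first-order terms uncoupled: row
    j contains derivatives of the j-th new unknown only.  This is indispensable
    for the maximum principle, since at a maximum of one component the gradients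
    of the others need not vanish. *)
Lemma first_rows_system (R : realType) (n m k : nat) (km : (k <= m)%N)
    (B : 'I_n -> 'M[R]_m) (C Q : 'M[R]_m)
    (Lambda : 'I_n -> 'M[R]_k) (Gamma : 'M[R]_k) (a z : 'cV[R]_m)
    (d : 'I_n -> 'cV[R]_m) (j : 'I_k) :
  Q \in unitmx ->
  (forall i, is_diag_mx (Lambda i)) ->
  (forall i, first_rows km (invmx Q *m B i *m Q) = pad_row0 km (Lambda i)) ->
  first_rows km (invmx Q *m C *m Q) = pad_row0 km Gamma ->
  (invmx Q *m (a + \sum_i B i *m d i + C *m z)) (widen_ord km j) 0 =
  (invmx Q *m a) (widen_ord km j) 0
  + \sum_i Lambda i j j * (invmx Q *m d i) (widen_ord km j) 0
  + \sum_l Gamma j l * (invmx Q *m z) (widen_ord km l) 0.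
Proof.
move=> Qu Ldiag BL CG; rewrite !mulmxDr mxE [X in X + _]mxE.
rewrite (first_rows_conj_mul _ _ Qu CG); congr (_ + _ + _).
rewrite mulmx_sumr summxE; apply: eq_bigr => i _.
rewrite (first_rows_conj_mul _ _ Qu (BL i)) (bigD1 j) //= big1 ?addr0 // => l lj.
by have /is_diag_mxP/(_ j l) := Ldiag i => ->; rewrite ?mul0r // eq_sym.
Qed.

(** * Invariance *)

Lemma invariant_S_hat (R : realType) (n m k : nat)
    (n_gt0 : (0 < n)%N) (km : (k <= m)%N)
    (Omega : set 'rV[R]_n) (B : 'I_n -> 'M[R]_m) (C Q : 'M[R]_m)
    (Lambda : 'I_n -> 'M[R]_k) (Gamma : 'M[R]_k) :
  open Omega -> bounded_set Omega ->
  Q \in unitmx ->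
  (forall i, is_diag_mx (Lambda i)) ->
  (forall i, first_rows km (invmx Q *m B i *m Q) = pad_row0 km (Lambda i)) ->
  first_rows km (invmx Q *m C *m Q) = pad_row0 km Gamma ->
  cooperative Gamma ->
  (forall (i : 'I_k) (j : 'I_m), 0 <= invmx Q (widen_ord km i) j) ->
  invariant_set Omega B C (S_hat km (invmx Q)).
Proof.
move=> oO bO Qu Ldiag BL CG coop P0 u u2 cu sys bdry x Ox.
move: bdry; rewrite S_hatE /= => bdry j.
pose P := invmx Q; pose W (p : 'I_k) := widen_ord km p.
have PE p (f : 'I_m -> 'rV[R]_n -> R) y :
    (\sum_l P (W p) l \*: f l) y = (P *m \col_l f l y) (W p) 0.
  by rewrite fct_sumE mxE; apply: eq_bigr => l _; rewrite mxE.
have wE p : (fun y => (P *m u y) (W p) 0) = \sum_l P (W p) l \*: component u l.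
  apply/funext => y; rewrite PE; congr ((_ *m _) _ _).
  by apply/colP => l; rewrite mxE.
apply: (@cooperative_max_principle _ _ _ Omega (Ordinal n_gt0)
  (fun i p => Lambda i p p) Gamma (fun p y => (P *m u y) (W p) 0)
  (fun p i => \sum_l P (W p) l \*: partial i (component u l))
  (fun p i => \sum_l P (W p) l \*: partial i (partial i (component u l)))
  oO bO coop) => //.
- move=> p; apply: (@within_continuous_comp _ _ _ _ u
    (fun v => (P *m v) (W p) 0) _ cu) => v _.
  exact: continuous_mulmx_coord.
- move=> p; rewrite wE; apply: second_partials_sum => l.
  by apply: second_partialsZ; apply: Cr2_second_partials.
- move=> p y Oy.
  have : 0 <= (P *m (vlaplacian u y + \sum_(i < n) B i *m vpartial i u y
      + C *m u y)) (W p) 0.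
    (* Nonnegativity of the rows of [P] preserves the sign of the system. *)
    by rewrite mxE; apply: sumr_ge0 => l _; rewrite mulr_ge0 // sys.
  rewrite (first_rows_system _ _ _ _ Qu Ldiag BL CG) big_split /=.
  congr (0 <= _ + _ + _).
    under [RHS]eq_bigr do rewrite PE.
    rewrite -summxE -mulmx_sumr; congr ((_ *m _) _ _).
    by apply/colP => l; rewrite !mxE summxE; apply: eq_bigr => i _; rewrite mxE.
  by apply: eq_bigr => i _; rewrite PE.
- by move=> p y /bdry.
- exact: subset_closure.
Qed.

Theorem theorem4 (R : realType) (n m k : nat)
    (n_gt0 : (0 < n)%N) (k_gt0 : (0 < k)%N) (km : (k <= m)%N)
    (Omega : set 'rV[R]_n) (B : 'I_n -> 'M[R]_m) (C Q : 'M[R]_m)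
    (Lambda : 'I_n -> 'M[R]_k) (Gamma : 'M[R]_k) :
  open Omega -> bounded_set Omega ->
  (exists V : {vspace 'cV[R]_m}, common_eigenspace B V /\ (\dim V)%VS = k) ->
  Q \in unitmx ->
  (forall j : 'I_k, is_common_eigenvector B (col (widen_ord km j) Q)) ->
  (forall i, real_jordan_form (invmx Q *m B i *m Q)) ->
  (forall i, is_diag_mx (Lambda i)) ->
  (forall i, first_rows km (invmx Q *m B i *m Q) = pad_row0 km (Lambda i)) ->
  first_rows km (invmx Q *m C *m Q) = pad_row0 km Gamma ->
  cooperative Gamma ->
  (forall (i : 'I_k) (j : 'I_m), 0 <= invmx Q (widen_ord km i) j) ->
  [/\ closed (S_hat km (invmx Q)),
      convex_set (S_hat km (invmx Q)) &
      invariant_set Omega B C (S_hat km (invmx Q))].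
Proof.
move=> oO bO _ Qu _ _ Ldiag BL CG coop P_ge0; split.
- exact: closed_S_hat.
- exact: convex_S_hat.
- exact: (invariant_S_hat n_gt0 oO bO Qu Ldiag BL CG coop P_ge0).
Qed.
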